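(* Let $X$ be a $T_0$ asymmetric locally convex space with topology $\alpha$ and dual space $X^*=(X,\alpha)^*$. Then $$\sigma(X,X^* )\subseteq\alpha\subseteq\tau(X,X^* ).$$
   Context: All vector spaces and cones are over the reals. An asymmetric seminorm on a vector space $X$ is a function $p:X\to[0,\infty)$ with $p(rx)=rp(x)$ for $r\ge 0$ and $p(x+y)\le p(x)+p(y)$. A family $\mathcal P$ of asymmetric seminorms on $X$ induces the topology with basis the sets $\{y\in X: p(y-x)<\epsilon\ \forall p\in F\}$, for $x\in X$, $\epsilon>0$, $F\subseteq\mathcal P$ finite. A vector space with such a topology is an asymmetric locally convex space. Its dual space $X^*$ is the cone of all linear, upper semicontinuous functions $X\to\mathbb R$. $X$ and $X^*$ are paired by $\langle x,\phi\rangle=\phi(x)$. $\sigma(X,X^* )$ is the topology on $X$ induced by the asymmetric seminorms $x\mapsto\max\{\phi(x),0\}$, $\phi\in X^*$. $\sigma(X^*,X)$ is the topology on $X^*$ of pointwise convergence on $X$. The Mackey topology $\tau(X,X^* )$ is the topology on $X$ induced by the asymmetric seminorms $p_B(x)=\sup_{\phi\in B}\max\{\phi(x),0\}$, where $B$ runs over all convex, $\sigma(X^*,X)$-compact subsets of $X^*$. *)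

(* Defs.v *)
From HB Require Import structures.
From mathcomp Require Import all_boot all_order all_algebra.
From mathcomp Require Import all_classical all_reals all_analysis.
Set Implicit Arguments.
Unset Strict Implicit.
Unset Printing Implicit Defensive.
Import Order.TTheory GRing.Theory Num.Theory.
Import numFieldNormedType.Exports.
Local Open Scope classical_set_scope.
Local Open Scope ring_scope.

(* A topology on X is given by its system of open sets, so that several
   topologies on one space can be compared by inclusion. *)

Section asymmetric_seminorms.
Context {R : realType} {X : lmodType R}.

Definition asymmetric_seminorm (p : X -> R) : Prop :=
  [/\ forall x, 0 <= p x,
      forall r x, 0 <= r -> p (r *: x) = r * p x &
      forall x y, p (x + y) <= p x + p y].

Definition seminorm_ball (F : set (X -> R)) (x : X) (e : R) : set X :=
  [set y | forall p, F p -> p (y - x) < e].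

Definition seminorm_basis (P : set (X -> R)) : set_system X :=
  [set V | exists F x e, [/\ finite_set F, F `<=` P, 0 < e &
                             V = seminorm_ball F x e]].

Definition induced_topology (P : set (X -> R)) : set_system X :=
  [set \bigcup_(V in D) V | D in subset^~ (seminorm_basis P)].

End asymmetric_seminorms.

(* preTopologicalLmodType imposes no compatibility between the topology and
   the linear structure; scalar multiplication by -1 need not be continuous. *)
Definition asymmetric_locally_convex (R : realType)
    (X : preTopologicalLmodType R) : Prop :=
  exists2 P : set (X -> R), P `<=` asymmetric_seminorm &
    (open : set_system X) = induced_topology P.

Definition upper_semicontinuous (R : realType) (X : topologicalType)
    (f : X -> R) : Prop :=
  forall x a, f x < a -> \forall y \near x, f y < a.

Section dual.
Context {R : realType} (X : preTopologicalLmodType R).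

Definition dual_cone : set (X -> R) :=
  [set phi | scalar phi /\ upper_semicontinuous phi].

Definition weak_topology : set_system X :=
  induced_topology [set (fun x => Num.max (phi x) 0) | phi in dual_cone].

(* sup set0 = 0, so the empty B yields the zero seminorm. *)
Definition sup_seminorm (B : set (X -> R)) (x : X) : R :=
  sup [set Num.max (phi x) 0 | phi in B].

(* The weak-star topology on the dual cone is the subspace topology inherited from
   {ptws X -> R}, and compactness of a subset of the dual cone does not depend on
   which of the two spaces it is computed in. *)
Definition weak_star_compact (B : set (X -> R)) : Prop :=
  B `<=` dual_cone /\ compact (B : set {ptws X -> R}).

Definition mackey_topology : set_system X :=
  induced_topology
    [set sup_seminorm B | B in
      [set B | weak_star_compact B /\ convex_set (B : set (X -> R^o))]].

End dual.

Arguments dual_cone {R} X.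
Arguments weak_topology {R} X.
Arguments mackey_topology {R} X.

(* Main.v *)
Require Import Defs.
From HB Require Import structures.
From mathcomp Require Import all_boot all_order all_algebra.
From mathcomp Require Import all_classical all_reals all_analysis.
From mathcomp Require Import lra ring.

(** The topology of an asymmetric locally convex space is generated by the sets
    [[set y | p (y - x) < e]], for [p] in a family [P] of asymmetric seminorms.

    The weak topology is coarser because it is generated by the sets
    [[set y | phi y < phi x + e]] with [phi] in the dual cone, and these are
    open by upper semicontinuity.

    The Mackey topology is finer because every [p] in [P] already belongs to
    the family of seminorms that defines it. Indeed, let [B] be the set of the
    linear functionals lying below [p]. Its elements are upper semicontinuous,
    since [phi y <= phi x + p (y - x)]; it is convex; and it is weak-star
    compact, being cut out by closed conditions inside the product of the
    segments from [- p (- x)] to [p x], which is compact by Tychonoff's theorem.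
    By the Hahn-Banach theorem [p x] is the maximum of [phi x] over [phi] in
    [B], and [p] is nonnegative, so [p] is the seminorm attached to [B]
    ([sup_seminorm_linear_minorants]).

    The Hahn-Banach theorem is obtained here without extending functionals
    from subspaces: below a sublinear functional there is by Zorn's lemma a
    minimal one, and a minimal sublinear functional is linear. Both the lower
    bounds of chains and the perturbation that proves linearity are pointwise
    infima of sublinear data, and [sublinear_inf] treats them together. *)

Set Implicit Arguments.
Unset Strict Implicit.
Unset Printing Implicit Defensive.
Import Order.TTheory GRing.Theory Num.Theory.
Import numFieldNormedType.Exports.
Local Open Scope classical_set_scope.
Local Open Scope ring_scope.

(** * The Hahn-Banach theorem by minimal sublinear functionals *)

(** Homogeneity is an inequality for positive factors only: applied to [r] and
    to [r^-1] it yields the equality, and it forces the value [0] at [0]. This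
    leaves less to check for functionals defined as infima. *)
Definition sublinear (R : realType) (X : lmodType R) (q : X -> R) : Prop :=
  (forall r x, 0 < r -> q (r *: x) <= r * q x) /\
  (forall x y, q (x + y) <= q x + q y).

Section sublinear_functionals.
Context {R : realType} {X : lmodType R}.
Implicit Types (p q : X -> R) (x y a : X) (r t : R).

Lemma sublinear0 q : sublinear q -> q 0 = 0.
Proof.
(* Homogeneity for the factor 1/2 bounds [q 0] above, subadditivity below. *)
move=> [qZ qD]; have := qD 0 0; have := qZ (1 / 2) 0.
rewrite scaler0 addr0 => /(_ ltac:(lra)); lra.
Qed.

Lemma sublinearZ q r x : sublinear q -> 0 <= r -> q (r *: x) = r * q x.
Proof.
move=> sq; rewrite le_eqVlt => /predU1P[<-|r0].
  by rewrite scale0r mul0r sublinear0.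
apply/le_anti/andP; split; first exact: sq.1.
have rV0 : 0 < r^-1 by rewrite invr_gt0.
have := sq.1 r^-1 (r *: x) rV0.
by rewrite scalerA mulVf ?gt_eqF// scale1r ler_pdivlMl.
Qed.

Lemma sublinear_geN q x : sublinear q -> - q (- x) <= q x.
Proof.
move=> sq; have := sq.2 x (- x).
by rewrite subrr sublinear0// -lerBlDr sub0r.
Qed.

Lemma asymmetric_seminorm_sublinear p : asymmetric_seminorm p -> sublinear p.
Proof. by move=> [_ pZ pD]; split=> // r x r0; rewrite pZ// ltW. Qed.

(** The sets [G x] need only be compatible with the vector operations up to
    domination, so that [G x] may consist of the values at [x] of a chain of
    sublinear functionals, or of the affine corrections of the values of one of
    them along a ray starting at [x]. *)
Lemma sublinear_inf (G : X -> set R) :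
  (forall x, G x !=set0) -> (forall x, has_lbound (G x)) ->
  (forall r x u, 0 < r -> G x u -> exists2 v, G (r *: x) v & v <= r * u) ->
  (forall x y u v, G x u -> G y v ->
     exists2 w, G (x + y) w & w <= u + v) ->
  sublinear (fun x => inf (G x)).
Proof.
move=> G0 Glb GZ GD; split=> [r x r0|x y].
  rewrite -ler_pdivrMl//; apply: lb_le_inf => // u Gu.
  rewrite ler_pdivrMl//; have [v Gv] := GZ _ _ _ r0 Gu.
  by apply: le_trans; exact: ge_inf.
rewrite -lerBlDr; apply: lb_le_inf => // u Gu.
rewrite lerBlDr -lerBlDl; apply: lb_le_inf => // v Gv.
rewrite lerBlDl; have [w Gw] := GD _ _ _ _ Gu Gv.
by apply: le_trans; exact: ge_inf.
Qed.

(** Zorn's lemma for the reversed pointwise order. The infimum of a chain is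
    finite, because every sublinear [s] below [p] satisfies
    [s x >= - s (- x) >= - p (- x)]; it is subadditive because, for [s]
    and [t] in the chain, [s x + t y] is at least [u (x + y)] for the smaller
    [u] of [s] and [t]. *)
Lemma sublinear_minimal p : sublinear p ->
  exists q, [/\ sublinear q, forall x, q x <= p x &
    forall q', sublinear q' -> (forall x, q' x <= q x) -> q' = q].
Proof.
move=> sp; pose T := {q | sublinear q /\ forall x, q x <= p x}.
pose below (s t : T) := `[< forall x, sval t x <= sval s x >].
have [| | | |[q [sq qp]] qmin] := @Zorn T below.
- by move=> s; apply/asboolP.
- move=> s t u /asboolP st /asboolP tu; apply/asboolP => x.
  exact: le_trans (tu x) (st x).
- move=> [s Ps] [t Pt] /asboolP /= st /asboolP /= ts; apply: eq_exist.
  by apply/funext => x; apply/le_anti; rewrite st ts.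
- move=> A Atot; have [->|/set0P[s0 As0]] := eqVneq A set0.
    by exists (exist _ p (conj sp (fun x => lexx (p x)))).
  pose G x := [set sval s x | s in A].
  have Glb x : has_lbound (G x).
    exists (- p (- x)) => _ [[s [ss sle]] _ <-] /=.
    by rewrite (le_trans _ (sublinear_geN x ss))// lerN2.
  have sG : sublinear (fun x => inf (G x)).
    apply: sublinear_inf => //.
    + by move=> x; exists (sval s0 x); exists s0.
    + move=> r x _ r0 [s As <-]; exists (sval s (r *: x)); first by exists s.
      exact: (proj1 (svalP s)).1.
    + move=> x y _ _ [s As <-] [t At <-].
      have [/asboolP st|/asboolP ts] := Atot _ _ As At.
        exists (sval t (x + y)); first by exists t.
        rewrite (le_trans ((proj1 (svalP t)).2 _ _))// lerD//; exact: st.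
      exists (sval s (x + y)); first by exists s.
      rewrite (le_trans ((proj1 (svalP s)).2 _ _))// lerD//; exact: ts.
  have Gp x : inf (G x) <= p x.
    apply: le_trans ((proj2 (svalP s0)) x).
    by apply: ge_inf => //; exists s0.
  exists (exist _ (fun x => inf (G x)) (conj sG Gp)) => s As.
  apply/asboolP => x /=.
  by apply: ge_inf => //; exists s.
exists q; split=> // q' sq' q'q.
have q'p x : q' x <= p x by exact: le_trans (qp x).
have /= := qmin (exist _ q' (conj sq' q'p)).
have qq' : below (exist _ q (conj sq qp)) (exist _ q' (conj sq' q'p)).
  exact/asboolP.
by move=> /(_ qq') /(congr1 sval).
Qed.

(** For sublinear [q] this is the largest sublinear functional below [q] whose
    value at [- a] is at most [- q a]. *)
Definition linearized_along q a x : R :=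
  inf [set q (x + t *: a) - t * q a | t in [set t | 0 <= t]].

Lemma linearized_along_has_lbound q a x : sublinear q ->
  has_lbound [set q (x + t *: a) - t * q a | t in [set t | 0 <= t]].
Proof.
move=> sq; exists (- q (- x)) => _ [t /= t0 <-].
rewrite -(sublinearZ _ sq t0) lerBrDr addrC lerBlDr.
by have := sq.2 (x + t *: a) (- x); rewrite addrAC subrr add0r.
Qed.

Lemma linearized_along_sublinear q a :
  sublinear q -> sublinear (linearized_along q a).
Proof.
move=> sq; apply: sublinear_inf.
- by move=> x; exists (q (x + 0 *: a) - 0 * q a); exists 0 => /=.
- by move=> x; exact: linearized_along_has_lbound.
- move=> r x _ r0 [t /= t0 <-].
  exists (q (r *: x + (r * t) *: a) - (r * t) * q a).
    by exists (r * t) => //=; rewrite mulr_ge0// ltW.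
  by rewrite mulrBr mulrA lerD2r -scalerA -scalerDr; exact: sq.1.
- move=> x y _ _ [s /= s0 <-] [t /= t0 <-].
  exists (q (x + y + (s + t) *: a) - (s + t) * q a).
    by exists (s + t) => //=; exact: addr_ge0.
  rewrite scalerDl addrACA (le_trans (lerB (sq.2 _ _) (lexx _)))//.
  by rewrite mulrDl opprD addrACA.
Qed.

Lemma linearized_along_le q a x t : sublinear q -> 0 <= t ->
  linearized_along q a x <= q (x + t *: a) - t * q a.
Proof.
move=> sq t0; apply: ge_inf; first exact: linearized_along_has_lbound.
by exists t.
Qed.

Lemma linearized_along_le_self q a x :
  sublinear q -> linearized_along q a x <= q x.
Proof.
move=> sq; have := linearized_along_le a x sq (lexx 0).
by rewrite scale0r addr0 mul0r subr0.
Qed.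

(** By minimality [q] equals [linearized_along q y], whence
    [q x <= q (x + y) - q y] and [q] is additive. *)
Lemma minimal_sublinear_scalar q : sublinear q ->
  (forall q', sublinear q' -> (forall x, q' x <= q x) -> q' = q) ->
  scalar q.
Proof.
move=> sq qmin.
have qD x y : q (x + y) = q x + q y.
  apply/le_anti; rewrite sq.2 /= -lerBrDr.
  rewrite -[in leLHS](qmin (linearized_along q y)).
  - have := linearized_along_le y x sq ler01.
    by rewrite scale1r mul1r.
  - exact: linearized_along_sublinear.
  - by move=> z; exact: linearized_along_le_self.
have qN x : q (- x) = - q x.
  by apply/eqP; rewrite -addr_eq0 -qD addNr sublinear0.
move=> r x y; rewrite qD; congr (_ + _).
have [r0|/ltW r0] := leP 0 r; first exact: sublinearZ.
by rewrite -[r *: x]opprK -scaleNr qN sublinearZ ?oppr_ge0// mulNr opprK.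
Qed.

(** A linear functional below [linearized_along p x0] also lies below [p], and
    its value at [- x0] is at most [- p x0], so that it touches [p] at [x0]. *)
Lemma hahn_banach_sublinear p x0 : sublinear p ->
  exists phi : X -> R, [/\ scalar phi, forall x, phi x <= p x & phi x0 = p x0].
Proof.
move=> sp.
have [phi [sphi phip]] := sublinear_minimal (linearized_along_sublinear x0 sp).
move=> /(minimal_sublinear_scalar sphi) lphi; exists phi.
have phi_le x : phi x <= p x.
  exact: le_trans (phip x) (linearized_along_le_self x0 x sp).
split=> //; apply/le_anti; rewrite phi_le/=.
have := le_trans (phip (- x0)) (linearized_along_le x0 (- x0) sp ler01).
rewrite scale1r addNr sublinear0// mul1r sub0r lerNr.
by rewrite -[- x0]scaleN1r (GRing.scalable_linear lphi) /= mulN1r opprK.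
Qed.

End sublinear_functionals.

(** * Topologies induced by families of functions *)

Section topologies_induced_by_seminorms.
Context {R : realType}.

Lemma seminorm_ball_open (X : preTopologicalLmodType R) (F : set (X -> R))
    (x : X) (e : R) :
  finite_set F -> (forall p, F p -> open [set y | p (y - x) < e]) ->
  open (seminorm_ball F x e).
Proof.
move=> /finite_fsetP[D FD] Fo.
rewrite openE => y Fy.
suff : nbhs y (\bigcap_(p in F) [set z | p (z - x) < e]) by exact: filterS.
rewrite FD; apply: filter_bigI => p pD.
have Fp : F p by rewrite FD.
by apply: open_nbhs_nbhs; split; [exact: Fo|exact: Fy].
Qed.

Lemma induced_topology_open (X : preTopologicalLmodType R)
    (P : set (X -> R)) :
  (forall p x e, P p -> 0 < e -> open [set y | p (y - x) < e]) ->
  induced_topology P `<=` open.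
Proof.
move=> Po _ [D DP <-]; apply: bigcup_open => V /DP[F [x [e [Ff FP e0 ->]]]].
by apply: seminorm_ball_open => // p /FP Pp; exact: Po.
Qed.

Lemma induced_topology_ball (X : lmodType R) (P : set (X -> R)) (p : X -> R)
    (x : X) (e : R) :
  P p -> 0 < e -> induced_topology P [set y | p (y - x) < e].
Proof.
move=> Pp e0; exists [set [set y | p (y - x) < e]]; last exact: bigcup_set1.
move=> _ ->; exists [set p], x, e; split => //; first by move=> _ ->.
by apply/seteqP; split=> [y py _ ->//|y]; apply.
Qed.

Lemma induced_topologyS (X : lmodType R) (P Q : set (X -> R)) :
  P `<=` Q -> induced_topology P `<=` induced_topology Q.
Proof.
move=> PQ _ [D DP <-]; exists D => // V /DP[F [x [e [Ff FP e0 ->]]]].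
by exists F, x, e; split=> //; exact: subset_trans PQ.
Qed.

End topologies_induced_by_seminorms.

(** * The linear functionals below an asymmetric seminorm *)

(** For an asymmetric seminorm [p] this is the polar of [[set x | p x <= 1]]. *)
Definition linear_minorants (R : realType) (X : lmodType R) (p : X -> R) :
    set (X -> R) :=
  [set phi | scalar phi /\ forall x, phi x <= p x].

Section linear_minorants.
Context {R : realType}.

(** The Hahn-Banach theorem makes [p x] a value [phi x]; truncating at [0] is
    harmless because [p x] is nonnegative. *)
Lemma sup_seminorm_linear_minorants (X : preTopologicalLmodType R)
    (p : X -> R) :
  asymmetric_seminorm p -> sup_seminorm (linear_minorants p) = p.
Proof.
move=> ap; apply/funext => x; have [p0 _ _] := ap.
have ubp : ubound [set Num.max (phi x) 0 | phi in linear_minorants p] (p x).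
  by move=> _ [phi [_ phip] <-]; rewrite ge_max phip p0.
have [phi [lphi phip phix]] :=
  hahn_banach_sublinear x (asymmetric_seminorm_sublinear ap).
have phiB : [set Num.max (phi x) 0 | phi in linear_minorants p] (p x).
  by exists phi => //; rewrite phix; apply/max_idPl.
apply/le_anti/andP; split; first by apply: ge_sup => //; exists (p x).
by apply: ub_le_sup => //; exists (p x).
Qed.

Lemma convex_linear_minorants (X : lmodType R) (p : X -> R) :
  convex_set (linear_minorants p : set (X -> R^o)).
Proof.
move=> f g l; rewrite !inE => -[lf fp] [lg gp].
pose s := l%:num; have s0 : 0 <= s := ge0 l.
have s1 : 0 <= 1 - s by rewrite subr_ge0 /s le1.
rewrite /linear_minorants /=.
change (scalar (fun x => s * f x + (1 - s) * g x) /\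
  forall x, s * f x + (1 - s) * g x <= p x); split.
- by move=> r x y; rewrite lf lg; ring.
- move=> x; have -> : p x = s * p x + (1 - s) * p x by ring.
  by apply: lerD; apply: ler_wpM2l; [exact: s0|exact: fp|exact: s1|exact: gp].
Qed.

Lemma eval_continuous (T : choiceType) (x : T) :
  continuous (fun f : {ptws T -> R} => (f x : R)).
Proof. exact: (@proj_continuous T (fun=> R) x). Qed.

(** To be used on a space of functions, with [f], [g] and [h] the evaluations at
    [r *: x + y], [x] and [y]: linearity is a conjunction of such relations. *)
Lemma closed_linear_relation (T : topologicalType) (f g h : T -> R) (r : R) :
  continuous f -> continuous g -> continuous h ->
  closed [set t | f t = r * g t + h t].
Proof.
move=> cf cg ch.
have -> : [set t | f t = r * g t + h t] =
    (fun t => f t - (r * g t + h t)) @^-1` [set x | x = 0].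
  apply/seteqP; split=> t /=; first by move=> ->; rewrite subrr.
  by move/eqP; rewrite subr_eq0 => /eqP.
apply: preimage_closed; last exact: closed_eq.
move=> t _; apply: cvgB; first exact: cf.
by apply: cvgD; [apply: cvgMr; exact: cg|exact: ch].
Qed.

(** Linearity turns the upper bound [phi <= p] into the two-sided bound
    [- p (- x) <= phi x <= p x], so Tychonoff's theorem applies. *)
Lemma compact_linear_minorants (X : lmodType R) (p : X -> R) :
  compact (linear_minorants p : set {ptws X -> R}).
Proof.
pose K := [set f : {ptws X -> R} | forall x, `[- p (- x), p x]%classic (f x)].
apply: (@subclosed_compact _ _ K).
- have -> : (linear_minorants p : set {ptws X -> R}) =
      (\bigcap_(i in [set: R * X * X])
        [set f : {ptws X -> R} |
          f (i.1.1 *: i.1.2 + i.2) = i.1.1 * f i.1.2 + f i.2]) `&`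
      \bigcap_(x in [set: X])
        ((fun f : {ptws X -> R} => f x) @^-1` [set y | y <= p x]).
    apply/seteqP; split=> [f [lf fp]|f [lf fp]]; split.
    + by move=> [[r x] y] _ /=; rewrite lf.
    + by move=> x _ /=.
    + by move=> r x y; exact: (lf (r, x, y)).
    + by move=> x; exact: fp.
  apply: closedI; apply: closed_bigI => i _.
    exact: (@closed_linear_relation {ptws X -> R} _ _ _ i.1.1
      (@eval_continuous _ (i.1.1 *: i.1.2 + i.2)) (@eval_continuous _ i.1.2)
      (@eval_continuous _ i.2)).
  apply: (@preimage_closed {ptws X -> R}); last exact: closed_le.
  by move=> f _; exact: (@eval_continuous _ i).
- apply: (@tychonoff X (fun=> R) (fun x => `[- p (- x), p x]%classic)) => x.
  exact: segment_compact.
- move=> f [lf fp] x /=; rewrite in_itv/= fp andbT lerNl.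
  by have := fp (- x); rewrite -scaleN1r (GRing.scalable_linear lf) /= mulN1r.
Qed.

(** If [phi x < a] then [phi y <= phi x + p (y - x)] stays below [a] on the
    [p]-ball around [x] of radius [a - phi x]. *)
Lemma linear_minorants_dual (X : preTopologicalLmodType R) (p : X -> R) :
  asymmetric_seminorm p ->
  (forall x e, 0 < e -> open [set y | p (y - x) < e]) ->
  linear_minorants p `<=` dual_cone X.
Proof.
move=> ap po phi [lphi phip]; split=> // x a phixa.
have p0 : p 0 = 0 by exact: sublinear0 (asymmetric_seminorm_sublinear ap).
have e0 : 0 < a - phi x by rewrite subr_gt0.
have : nbhs x [set y | p (y - x) < a - phi x].
  by apply: open_nbhs_nbhs; split; [exact: po|rewrite /= subrr p0].
apply: filterS => y /= pyx; rewrite -(ltrD2r (- phi x)).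
by rewrite -(GRing.zmod_morphism_linear lphi); exact: le_lt_trans pyx.
Qed.

End linear_minorants.

Theorem corollary3p12 (R : realType) (X : preTopologicalLmodType R)
    (XT0 : @kolmogorov_space X) (Xalc : asymmetric_locally_convex X) :
  weak_topology X `<=` (open : set_system X) /\
  (open : set_system X) `<=` mackey_topology X.
Proof.
split.
  apply: induced_topology_open => _ x e [phi [lphi uphi] <-] e0.
  have phiB y := GRing.zmod_morphism_linear lphi y x.
  rewrite openE => y /=; rewrite gt_max e0 andbT phiB ltrBlDr => /uphi.
  by apply: filterS => z /= zx; rewrite gt_max e0 andbT phiB ltrBlDr.
have [P Pp oP] := Xalc; rewrite oP; apply: induced_topologyS => p Pp'.
exists (linear_minorants p); last exact/sup_seminorm_linear_minorants/Pp.
split; last exact: convex_linear_minorants.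
split; last exact: compact_linear_minorants.
apply: linear_minorants_dual; first exact: Pp.
by move=> x e e0; rewrite oP; exact: induced_topology_ball.
Qed.
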